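(* Let $(H,\mathcal B,\mu_1)$ be an abelian normalizable hypergroup such that $G(H,\mathcal B)$ is a finite group. Then $(H,\mathcal B)$ is Burnside if and only if the following identity holds in the dual hypergroup $\widehat{(H,\mathcal B,\mu_1)}$: $$\Big(\prod_{j=1}^m\mu_j\Big)^2=\frac{|G(H,\mathcal B)|}{n(H,\mathcal B,\mu_1)}\Big(\sum_{j\in\mathcal I_{G(H,\mathcal B)}}\widehat h_j\,\mu_j\Big).$$
   Context: Hypergroup: a finite-dimensional unital associative $\mathbb C$-algebra $H$ with a $\mathbb C$-basis $\mathcal B=\{x_1=1,\dots,x_m\}$ (standard elements), $x_ix_j=\sum_kN_{i,j}^kx_k$, $N_{i,j}^k\in\mathbb C$, and an involution $i\mapsto i^*$ of $\mathcal I=\{1,\dots,m\}$ such that $N_{i,i^*}^1>0$ and $N_{i,j}^1=0$ if $j\ne i^*$. Standing assumption: the involution $x_i\mapsto x_i^*:=x_{i^*}$ extends (conjugate-linearly) to an anti-involution of $H$, i.e. $N_{j^*,i^*}^{k^*}=\overline{N_{i,j}^k}$, so $H$ is a $*$-algebra (hence semisimple), and if $H$ is commutative then $\mu(x_{i^*})=\overline{\mu(x_i)}$ for every algebra morphism $\mu:H\to\mathbb C$. Put $h_i:=1/N_{i,i^*}^1$. Abelian means $H$ is commutative. Let $(H,\mathcal B)$ be abelian. $\widehat{\mathcal B}=\{\mu_1,\dots,\mu_m\}$ denotes the set of all unital algebra morphisms $H\to\mathbb C$, a basis of $H^*$; $F_j\in H$ is the primitive idempotent with $\mu_i(F_j)=\delta_{i,j}$.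 An abelian normalizable hypergroup $(H,\mathcal B,\mu_1)$ is an abelian hypergroup with a chosen $\mu_1\in\widehat{\mathcal B}$ such that $d_i:=\mu_1(x_i)\neq0$ for all $i$. Its order is $n(H,\mathcal B,\mu_1)=\sum_i h_i|d_i|^2$. Dual hypergroup $\widehat{(H,\mathcal B,\mu_1)}$: $H^*$ with basis $\widehat{\mathcal B}$, product $(f\star g)(x_i/d_i)=f(x_i/d_i)g(x_i/d_i)$ for all $i$, unit $\mu_1$, involution $\mu_{j^\#}(x_i/d_i)=\mu_j(x_{i^*}/\overline{d_i})$. Write $\mu_i\star\mu_j=\sum_k\widehat p_k(i,j)\mu_k$ and $\widehat h_j:=1/\widehat p_1(j,j^\#)$. Products and squares of the $\mu_j$ are taken with respect to $\star$. Grouplike elements: $G(H,\mathcal B)=\{x_i\in\mathcal B: x_ix_{i^*}=N_{i,i^*}^1\,1\}$. ''$G(H,\mathcal B)$ is a finite group'' means that the set $\{x_i/d_i: x_i\in G(H,\mathcal B)\}$ is a (finite) group under multiplication in $H$. Burnside: $(H,\mathcal B)$ is Burnside if for every $a\in\mathcal B$: there is $\mu\in\widehat{\mathcal B}$ with $\mu(a)=0$ if and only if $a$ is not grouplike. Support: for a subset $\mathcal S\subseteq\mathcal B$ closed under the involution and such that $L=\mathbb C[\mathcal S]$ (linear span) is a subalgebra, let $\lambda_{(L,\mathcal S)}\in L$ be the primitive idempotent of $L$ corresponding to the character $\mu_1|_L$; the support $\mathcal I_{(L,\mathcal S)}\subseteq\mathcal I$ is the subset with $\lambda_{(L,\mathcal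 S)}=\sum_{j\in\mathcal I_{(L,\mathcal S)}}F_j$. $\mathcal I_{G(H,\mathcal B)}$ is the support for $\mathcal S=G(H,\mathcal B)$.
   Formalization: The formal statement assumes explicitly that the dual involution exists, i.e. that each functional defining μ_{j^#} is again a character; this is not automatic for complex normalized structure constants, and without it the weights ĥ_j are undefined. *)

(* Defs.v *)
From HB Require Import structures.
From mathcomp Require Import all_boot all_order all_algebra all_field.
From mathcomp Require Import reals complex.

Set Implicit Arguments.
Unset Strict Implicit.
Unset Printing Implicit Defensive.

Import Order.TTheory GRing.Theory Num.Theory.
Local Open Scope ring_scope.

(* A basis with m standard elements is a tuple indexed by 'I_r.+1, m = r.+1;  *)
(* the distinguished index written 1 in the mathematics is ord0 here.         *)

Section Hypergroup.
Variables (C : numClosedFieldType) (H : falgType C) (r : nat).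
Implicit Types (x : r.+1.-tuple H) (star : 'I_r.+1 -> 'I_r.+1).

Definition strconst x (i j k : 'I_r.+1) : C := coord x k (tnth x i * tnth x j).

Record hypergroup x star : Prop := Hypergroup {
  hg_basis : basis_of fullv x;
  hg_one : tnth x ord0 = 1;
  hg_starK : involutive star;
  hg_pos : forall i, 0 < strconst x i (star i) ord0;
  hg_zero : forall i j, j != star i -> strconst x i j ord0 = 0;
  (* the conjugate-linear extension of x_i |-> x_(i^* ) reverses products *)
  hg_anti : forall i j k,
    strconst x (star j) (star i) (star k) = (strconst x i j k)^* }.

Definition hgabelian : Prop := forall u v : H, u * v = v * u.

Definition hgweight x star (i : 'I_r.+1) : C := 1 / strconst x i (star i) ord0.

Definition grouplike x star (i : 'I_r.+1) : bool :=
  tnth x i * tnth x (star i) == strconst x i (star i) ord0 *: 1.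

Definition grouplikes x star : {set 'I_r.+1} := [set i | grouplike x star i].

(* e is an idempotent of the subspace L that does not split inside L. *)
Definition primitive_idempotent (L : {vspace H}) (e : H) : Prop :=
  [/\ e \in L, e * e = e, e != 0
    & forall e1 e2 : H, e1 \in L -> e2 \in L ->
        e1 * e1 = e1 -> e2 * e2 = e2 -> e1 * e2 = 0 -> e2 * e1 = 0 ->
        e = e1 + e2 -> e1 = 0 \/ e2 = 0].

Definition mulgroup (E : seq H) : Prop :=
  [/\ 1 \in E,
      forall u v, u \in E -> v \in E -> u * v \in E
    & forall u, u \in E -> exists2 v, v \in E & u * v = 1 /\ v * u = 1].

(* The dual space H^* is 'Hom(H, C^o); 'AHom(H, C^o) is the type of unital    *)
(* algebra morphisms H -> C, so a bijective mu enumerates all of them. The    *)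
(* chosen character mu_1 is mu ord0.                                          *)
Section Characters.
Variable mu : 'I_r.+1 -> 'AHom(H, C^o).

Definition degree x (i : 'I_r.+1) : C := mu ord0 (tnth x i).

Definition hgorder x star : C :=
  \sum_(i < r.+1) hgweight x star i * `|degree x i| ^+ 2.

Definition normalizable x : Prop := forall i, degree x i != 0.

Definition normalized x (i : 'I_r.+1) : H := (degree x i)^-1 *: tnth x i.

Definition burnside x star : Prop :=
  forall i, (exists j, mu j (tnth x i) = 0) <-> ~ grouplike x star i.

Definition dual_idempotents (F : 'I_r.+1 -> H) : Prop :=
  forall j, primitive_idempotent fullv (F j) /\
            forall i, mu i (F j) = (i == j)%:R.

(* The primitive idempotent of L attached to the character mu_1 of L is the   *)
(* one on which this character takes the value 1.                             *)
Definition is_support x (F : 'I_r.+1 -> H) (S I : {set 'I_r.+1}) : Prop :=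
  exists lambda : H,
    [/\ primitive_idempotent <<[seq tnth x i | i in S]>>%VS lambda,
        mu ord0 lambda = 1
      & lambda = \sum_(j in I) F j].

(* The product of H^* determined by                                           *)
(*   (f * g)(x_i / d_i) = f(x_i / d_i) g(x_i / d_i),                          *)
(* written out through v = \sum_i (v_i d_i) (x_i / d_i); see dual_mulE.       *)
Definition dual_mul x (f g : 'Hom(H, C^o)) : 'Hom(H, C^o) :=
  linfun (fun v : H => \sum_(i < r.+1) (coord x i v * degree x i) *:
                         (f (normalized x i) * g (normalized x i) : C^o)).

Definition dual_basis : r.+1.-tuple 'Hom(H, C^o) :=
  [tuple (mu j : 'Hom(H, C^o)) | j < r.+1].

Definition dual_strconst x (i j k : 'I_r.+1) : C :=
  coord dual_basis k (dual_mul x (mu i) (mu j)).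

(* The condition mu_(j#)(x_i / d_i) = mu_j(x_(i^* ) / (d_i)^* ). For j fixed the *)
(* right-hand side extends to a linear form on H, which may fail to be an     *)
(* algebra morphism when the structure constants of the x_i / d_i are not     *)
(* all real; a map sharp as below exists only if every such form is one.      *)
Definition dual_involution x star (sharp : 'I_r.+1 -> 'I_r.+1) : Prop :=
  forall i j, mu (sharp j) (normalized x i) =
              mu j ((degree x i)^*^-1 *: tnth x (star i)).

Definition dual_weight x (sharp : 'I_r.+1 -> 'I_r.+1) (j : 'I_r.+1) : C :=
  1 / dual_strconst x j (sharp j) ord0.

Definition dual_prod x : 'Hom(H, C^o) :=
  \big[dual_mul x / (mu ord0 : 'Hom(H, C^o))]_(j < r.+1) (mu j : 'Hom(H, C^o)).

Lemma dual_mulE x (f g : 'Hom(H, C^o)) (i : 'I_r.+1) :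
  basis_of fullv x -> normalizable x ->
  dual_mul x f g (normalized x i) = f (normalized x i) * g (normalized x i).
Proof.
move=> xB nz.
set h := fun v : H => \sum_(i < r.+1) (coord x i v * degree x i) *:
   (f (normalized x i) * g (normalized x i) : C^o).
have hlin : linear h.
  move=> a u v; rewrite /h scaler_sumr -big_split /=.
  apply: eq_bigr => k _; rewrite linearP /=.
  have E (b c e : C) (y : C^o) :
      ((a * b + c) * e) *: y = a *: ((b * e) *: y) + (c * e) *: y.
    by rewrite mulrDl scalerDl (scalerA a) mulrA.
  exact: E.
pose HL := GRing.isLinear.Build C H C^o *:%R h hlin.
pose h' : {linear H -> C^o} := HB.pack h HL.
have -> : dual_mul x f g = linfun h' by [].
have cE k : coord x k (normalized x i) = (degree x i)^-1 * (i == k)%:R.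
  by rewrite /normalized linearZ /= (tnth_nth 0) coord_free ?(basis_free xB).
rewrite lfunE /= /h (bigD1 i) //= big1 ?addr0 => [|k kNi].
  by rewrite cE eqxx mulr1 mulVf ?scale1r.
by rewrite cE eq_sym (negPf kNi) mulr0 mul0r scale0r.
Qed.

End Characters.

End Hypergroup.

(* Main.v *)
(* Let tau be the coefficient of the unit. The form tau (u v^* ) is positive   *)
(* definite, so F_j^* = F_j and mu_j(v^* ) = conj (mu_j(v)); moreover          *)
(* tau(F_0) = 1 / n and the dual weight of mu_j is n tau(F_j). Hence the right-  *)
(* hand side takes at X_i = x_i / d_i the value |G| tau(lambda X_i), and since *)
(* |G| lambda is the sum of the group of the X_g, this value is 1 if x_i is    *)
(* grouplike and 0 otherwise. The left-hand side takes there the value         *)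
(* (\prod_j mu_j(X_i))^2, which vanishes iff some mu_j(x_i) does; at a         *)
(* grouplike x_i the product has modulus 1 and is real, the involution of the  *)
(* dual permuting its factors by conjugation, so its square is 1.              *)

Require Import Defs.
From HB Require Import structures.
From mathcomp Require Import all_boot all_order all_algebra all_field.
From mathcomp Require Import reals complex.

Set Implicit Arguments.
Unset Strict Implicit.
Unset Printing Implicit Defensive.

Import Order.TTheory GRing.Theory Num.Theory.
Local Open Scope ring_scope.

(** A linear form on H is determined by its values at the normalized elements X_i, where the dual
    product is pointwise, so the identity amounts to one scalar equation per index
    ([hom_normalizedP]). The group hypothesis forces lambda to be the average of the normalized
    grouplikes ([support_idempotent]), so the right-hand side is the indicator of the grouplike
    indices ([tau_grouplike_sum]). The left-hand side is the square of prod_j mu_j(X_i): it is 1 at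
    every grouplike ([prod_charval_sqr]) and vanishes exactly when some character kills x_i. The
    equation at a grouplike thus always holds, and elsewhere it is the Burnside condition. *)

Section StarAlgebra.
Variables (C : numClosedFieldType) (H : falgType C) (r : nat).
Variables (x : r.+1.-tuple H) (star : 'I_r.+1 -> 'I_r.+1).
Hypothesis hH : hypergroup x star.

(** * The involution and its positive definite form *)

Lemma hg_coordE v : v = \sum_i coord x i v *: tnth x i.
Proof.
rewrite {1}(coord_basis (hg_basis hH) (memvf v)).
by apply: eq_bigr => i _; rewrite (tnth_nth 0).
Qed.

Lemma coord_hg i k : coord x k (tnth x i) = (i == k)%:R.
Proof. by rewrite (tnth_nth 0) coord_free ?(basis_free (hg_basis hH)). Qed.

Lemma coord_inj u v : (forall k, coord x k u = coord x k v) -> u = v.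
Proof.
by move=> e; rewrite (hg_coordE u) (hg_coordE v); apply: eq_bigr => k _; rewrite e.
Qed.

Definition hgstar (v : H) : H := \sum_i (coord x i v)^* *: tnth x (star i).

Lemma coord_hgstar k v : coord x k (hgstar v) = (coord x (star k) v)^*.
Proof.
rewrite linear_sum (bigD1 (star k)) //= big1 => [|i iNk].
  by rewrite linearZ /= coord_hg (hg_starK hH) eqxx mulr1 addr0.
rewrite linearZ /= coord_hg -(inj_eq (inv_inj (hg_starK hH))) (hg_starK hH).
by rewrite (negPf iNk) mulr0.
Qed.

Lemma hgstarK : involutive hgstar.
Proof.
by move=> v; apply: coord_inj => k; rewrite !coord_hgstar conjCK (hg_starK hH).
Qed.

Lemma hgstarZ a v : hgstar (a *: v) = a^* *: hgstar v.
Proof.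
by apply: coord_inj => k; rewrite linearZ /= !coord_hgstar linearZ /= rmorphM.
Qed.

Lemma hgstar_sum (I : finType) (P : pred I) (u : I -> H) :
  hgstar (\sum_(i | P i) u i) = \sum_(i | P i) hgstar (u i).
Proof.
apply: coord_inj => k; rewrite coord_hgstar !linear_sum rmorph_sum /=.
by apply: eq_bigr => i _; rewrite coord_hgstar.
Qed.

Lemma hgstar_basis i : hgstar (tnth x i) = tnth x (star i).
Proof.
apply: coord_inj => k; rewrite coord_hgstar !coord_hg conjC_nat.
by rewrite -(inj_eq (inv_inj (hg_starK hH))) (hg_starK hH).
Qed.

Lemma hgstarM u v : hgstar (u * v) = hgstar v * hgstar u.
Proof.
have hb i j : hgstar (tnth x i * tnth x j) = tnth x (star j) * tnth x (star i).
  apply: coord_inj => k; rewrite coord_hgstar -/(strconst x i j _).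
  by rewrite -(hg_anti hH) (hg_starK hH).
rewrite (hg_coordE u) (hg_coordE v) mulr_suml !hgstar_sum mulr_sumr.
apply: eq_bigr => i _; rewrite mulr_sumr mulr_suml hgstar_sum.
apply: eq_bigr => j _.
rewrite -scalerAl -scalerAr !hgstarZ hb !hgstar_basis.
by rewrite -scalerAl -scalerAr !scalerA mulrC.
Qed.

Lemma coord0_mul_star u i :
  coord x ord0 (u * tnth x (star i)) =
  coord x i u * strconst x i (star i) ord0.
Proof.
rewrite {1}(hg_coordE u) mulr_suml linear_sum (bigD1 i) //= big1 => [|k kNi].
  by rewrite -scalerAl linearZ addr0.
rewrite -scalerAl linearZ /= -/(strconst x k (star i) ord0) (hg_zero hH) ?mulr0 //.
by rewrite (inj_eq (inv_inj (hg_starK hH))) eq_sym.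
Qed.

(** The unit coefficient of v v^* is the sum of |v_i|^2 / h_i, whose terms are all nonnegative. *)
Lemma hgstar_faithful v : v * hgstar v = 0 -> v = 0.
Proof.
move=> /(congr1 (coord x ord0)); rewrite linear0 /hgstar mulr_sumr linear_sum /=.
under eq_bigr => i _ do
  rewrite -scalerAr linearZ /= coord0_mul_star mulrA [_^* * _]mulrC -normCK.
have ge0 i : 0 <= `|coord x i v| ^+ 2 * strconst x i (star i) ord0.
  by rewrite mulr_ge0 ?exprn_ge0 // ltW // (hg_pos hH).
move=> /(psumr_eq0P (fun i _ => ge0 i)) e; apply: coord_inj => k.
move/eqP: (e k isT); rewrite mulf_eq0 expf_eq0 normr_eq0 linear0.
by rewrite (gt_eqF (hg_pos hH k)) orbF => /eqP.
Qed.

End StarAlgebra.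

(** * Characters, primitive idempotents and orthogonality *)

Section Characters.
Variables (C : numClosedFieldType) (H : falgType C) (r : nat).
Variables (x : r.+1.-tuple H) (star : 'I_r.+1 -> 'I_r.+1).
Hypotheses (hH : hypergroup x star) (hab : hgabelian H).
Variables (mu : 'I_r.+1 -> 'AHom(H, C^o)) (F : 'I_r.+1 -> H).
Hypothesis hF : forall i j, mu i (F j) = (i == j)%:R.

Local Notation hgstar := (hgstar x star).
Local Notation tau := (coord x ord0).

(* Typed in [C] rather than in the regular algebra [C^o]. *)
Definition charval (j : 'I_r.+1) (v : H) : C := mu j v.

Lemma charvalM j u v : charval j (u * v) = charval j u * charval j v.
Proof. by rewrite /charval rmorphM. Qed.

Lemma charval1 j : charval j 1 = 1.
Proof. by rewrite /charval rmorph1. Qed.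

Lemma charval0 j : charval j 0 = 0.
Proof. by rewrite /charval linear0. Qed.

Lemma charvalZ j a v : charval j (a *: v) = a * charval j v.
Proof. by rewrite /charval linearZ. Qed.

Lemma charval_sum j (I : Type) (s : seq I) (P : pred I) (u : I -> H) :
  charval j (\sum_(i <- s | P i) u i) = \sum_(i <- s | P i) charval j (u i).
Proof. by rewrite /charval linear_sum. Qed.

Lemma charvalF i j : charval i (F j) = (i == j)%:R.
Proof. exact: hF. Qed.

Lemma charval_combF i (a : 'I_r.+1 -> C) :
  charval i (\sum_j a j *: F j) = a i.
Proof.
rewrite charval_sum (bigD1 i) //= big1 => [|j jNi].
  by rewrite charvalZ charvalF eqxx mulr1 addr0.
by rewrite charvalZ charvalF eq_sym (negPf jNi) mulr0.
Qed.

(** The [F j] are independent, since the characters separate them, and their number is the dimension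
    of H. *)
Lemma charval_expand v : v = \sum_j charval j v *: F j.
Proof.
pose Ft := [tuple F j | j < r.+1].
have FtE (j : 'I_r.+1) : Ft`_j = F j by rewrite -tnth_nth tnth_mktuple.
have Ffree : free Ft.
  apply/freeP => k; under eq_bigr => j _ do rewrite FtE.
  by move=> e i; rewrite -(charval_combF i k) e charval0.
have Fbasis : basis_of fullv Ft.
  rewrite basisEfree Ffree subvf size_tuple -(size_basis (hg_basis hH)) /=.
  by rewrite leqnn.
have := coord_basis Fbasis (memvf v); under eq_bigr => j _ do rewrite FtE.
by move=> e; rewrite {1}e; apply: eq_bigr => j _; rewrite [in RHS]e charval_combF.
Qed.

Lemma charval_inj u v : (forall j, charval j u = charval j v) -> u = v.
Proof.
move=> e; rewrite (charval_expand u) (charval_expand v).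
by apply: eq_bigr => j _; rewrite e.
Qed.

Lemma idempotent_mul j v : F j * v = charval j v *: F j.
Proof.
apply: charval_inj => i; rewrite charvalM charvalZ charvalF.
by case: eqP => [->|_]; rewrite ?mul0r ?mulr0 // mulrC.
Qed.

Lemma hgstar_idempotent j : hgstar (F j) = F j.
Proof.
have Fid : F j * F j = F j by rewrite idempotent_mul charvalF eqxx scale1r.
have Fj0 : F j != 0.
  apply/eqP => e; have := charvalF j j; rewrite e eqxx.
  by rewrite charval0 => /eqP; rewrite eq_sym oner_eq0.
set a := charval j (hgstar (F j)).
have aN0 : a != 0.
  apply: contraNneq Fj0 => a0; apply/eqP/(hgstar_faithful hH).
  by rewrite idempotent_mul -/a a0 scale0r.
have a1 : a = 1.
  apply: (mulfI aN0); rewrite mulr1 -charvalM -hgstarM //.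
  by rewrite Fid.
have e : F j * hgstar (F j) = F j by rewrite idempotent_mul -/a a1 scale1r.
by rewrite -{2}e -{1}e hgstarM // (hgstarK hH) hab.
Qed.

Lemma charval_hgstar j v : charval j (hgstar v) = (charval j v)^*.
Proof.
have := congr1 (fun w => charval j (hgstar w)) (idempotent_mul j v).
rewrite hgstarM // hgstarZ // hgstar_idempotent charvalM charvalZ.
by rewrite !charvalF eqxx !mulr1.
Qed.

Lemma charval_star j i : charval j (tnth x (star i)) = (charval j (tnth x i))^*.
Proof. by rewrite -hgstar_basis // charval_hgstar. Qed.

(** Both sides come from computing the unit coefficient of F_j x_i^*. *)
Lemma coord_idempotent i j :
  coord x i (F j) =
  hgweight x star i * (charval j (tnth x i))^* * tau (F j).
Proof.
have N0 := lt0r_neq0 (hg_pos hH i).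
apply: (mulIf N0); rewrite -(coord0_mul_star hH) idempotent_mul charval_star.
by rewrite linearZ /= /hgweight div1r [RHS]mulrC -!mulrA mulVKf.
Qed.

(** This is mu_j(F_j) = 1 with F_j expanded in the standard basis. *)
Lemma tau_idempotent j :
  tau (F j) * \sum_i hgweight x star i * `|charval j (tnth x i)| ^+ 2 = 1.
Proof.
have <- : charval j (F j) = 1 by rewrite charvalF eqxx.
rewrite [in RHS](hg_coordE hH (F j)) charval_sum mulr_sumr.
apply: eq_bigr => i _; rewrite charvalZ (coord_idempotent i) normCK.
by rewrite [RHS]mulrAC [RHS]mulrC -[in RHS]mulrA [_^* * _]mulrC.
Qed.

Lemma tau_idempotent0 : tau (F ord0) = (hgorder mu x star)^-1.
Proof.
have e := tau_idempotent ord0.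
have n0 : hgorder mu x star != 0.
  by apply: contra_eq_neq e => /= e; rewrite [X in _ * X]e mulr0 eq_sym oner_neq0.
by apply: (mulIf n0); rewrite mulVf.
Qed.

(** * The dual hypergroup, read at the normalized elements *)

Hypothesis hd : normalizable mu x.

Local Notation X := (normalized mu x).
Local Notation d := (degree mu x).

Lemma normalizedK i : d i *: X i = tnth x i.
Proof. by rewrite /normalized scalerA divff ?scale1r. Qed.

Lemma charval_normalized j i : charval j (X i) = (d i)^-1 * charval j (tnth x i).
Proof. exact: charvalZ. Qed.

Lemma charval0_normalized i : charval ord0 (X i) = 1.
Proof. by rewrite charval_normalized mulVf // hd. Qed.

Lemma normalized_expand v : v = \sum_i (coord x i v * d i) *: X i.
Proof.
rewrite {1}(hg_coordE hH v); apply: eq_bigr => i _.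
by rewrite -scalerA normalizedK.
Qed.

Lemma hom_normalizedE (f : 'Hom(H, C^o)) v :
  f v = \sum_i (coord x i v * d i) * (f (X i) : C).
Proof.
rewrite {1}(normalized_expand v) linear_sum; apply: eq_bigr => i _.
by rewrite linearZ.
Qed.

Lemma hom_normalizedP (f g : 'Hom(H, C^o)) :
  (forall i, f (X i) = g (X i)) <-> f = g.
Proof.
split=> [e|-> //]; apply/lfunP => v; rewrite !hom_normalizedE.
by apply: eq_bigr => i _; rewrite e.
Qed.

Lemma coord_dual_basis k (f : 'Hom(H, C^o)) :
  coord (dual_basis mu) k f = f (F k).
Proof.
have bE (j : 'I_r.+1) : (dual_basis mu)`_j = mu j by rewrite -tnth_nth tnth_mktuple.
have sumE (a : 'I_r.+1 -> C) i :
    (\sum_j a j *: (dual_basis mu)`_j) (F i) = a i :> C.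
  rewrite sum_lfunE (bigD1 i) //= big1 => [|j jNi].
    by rewrite scale_lfunE bE hF eqxx addr0; exact: mulr1.
  by rewrite scale_lfunE bE hF (negPf jNi) scaler0.
have bfree : free (dual_basis mu).
  by apply/freeP => a e i; rewrite -(sumE a i) e lfunE.
have -> : f = \sum_j (f (F j) : C) *: (dual_basis mu)`_j.
  apply/lfunP => v; rewrite (charval_expand v) !linear_sum.
  by apply: eq_bigr => i _; rewrite !linearZ /= [X in _ = _ *: X]sumE.
by rewrite coord_sum_free // sumE.
Qed.

Lemma dual_mul_normalized f g i :
  dual_mul mu x f g (X i) = (f (X i) : C) * g (X i) :> C.
Proof. exact: dual_mulE (hg_basis hH) hd. Qed.

Lemma dual_prod_normalized i :
  dual_prod mu x (X i) = \prod_j charval j (X i) :> C.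
Proof.
rewrite /dual_prod.
rewrite (big_morph (fun f : 'Hom(H, C^o) => f (X i) : C)
  (fun f g => dual_mul_normalized f g i) (charval0_normalized i)).
by [].
Qed.

Section Sharp.
Variable sharp : 'I_r.+1 -> 'I_r.+1.
Hypothesis hsharp : dual_involution mu x star sharp.

Lemma charval_sharp i j : charval (sharp j) (X i) = (charval j (X i))^*.
Proof.
rewrite [LHS]hsharp -/(charval _ _) charvalZ charval_star charval_normalized.
by rewrite rmorphM fmorphV.
Qed.

(** Conjugating twice leaves the values at all X_i unchanged, and [F j] tells distinct characters
    apart. *)
Lemma sharpK : involutive sharp.
Proof.
move=> j; have e : charval (sharp (sharp j)) (F j) = charval j (F j).
  rewrite /charval !hom_normalizedE; apply: eq_bigr => i _.
  by rewrite -!/(charval _ _) !charval_sharp conjCK.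
apply/eqP; move: e; rewrite !charvalF eqxx.
by case: eqP => // _ /eqP; rewrite eq_sym oner_eq0.
Qed.

(** The constant is the value of the dual product at F_0, namely tau(F_0) times the sum of h_i
    |mu_j(x_i)|^2, which [tau_idempotent] inverts. *)
Lemma dual_strconst_sharp j :
  dual_strconst mu x j (sharp j) ord0 * tau (F j) = tau (F ord0).
Proof.
rewrite /dual_strconst coord_dual_basis hom_normalizedE.
rewrite -[RHS]mulr1 -(tau_idempotent j) mulrCA [LHS]mulrC; congr (_ * _).
rewrite mulr_sumr; apply: eq_bigr => i _.
rewrite dual_mul_normalized -!/(charval _ _) charval_sharp -normCK.
rewrite coord_idempotent charval_normalized normrM normfV exprMn exprVn.
have dN : `|d i| ^+ 2 != 0 by rewrite expf_neq0 // normr_eq0 hd.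
rewrite -[charval ord0 _]/(d i) [_ * tau _]mulrC -!mulrA; congr (_ * (_ * _)); congr (_ * _).
by rewrite mulrA [_^* * _]mulrC -normCK mulVKf.
Qed.

Lemma dual_weightE j :
  dual_weight mu x sharp j = hgorder mu x star * tau (F j).
Proof.
have n0 k : tau (F k) != 0.
  by apply: contra_eq_neq (tau_idempotent k) => ->; rewrite mul0r eq_sym oner_neq0.
have e := dual_strconst_sharp j; rewrite tau_idempotent0 in e.
have nE : hgorder mu x star != 0 by rewrite -invr_eq0 -tau_idempotent0.
rewrite /dual_weight div1r; apply: invr_inj; rewrite invrK invfM -e.
by rewrite mulfK.
Qed.

Lemma weighted_sum_charvalE (I : {set 'I_r.+1}) v :
  (\sum_(j in I) dual_weight mu x sharp j *: (mu j : 'Hom(H, C^o))) v =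
  hgorder mu x star * tau ((\sum_(j in I) F j) * v) :> C.
Proof.
rewrite sum_lfunE [_ * v]mulr_suml linear_sum mulr_sumr; apply: eq_bigr => j _.
rewrite scale_lfunE dual_weightE idempotent_mul linearZ /= -/(charval j v).
by rewrite [RHS]mulrCA [RHS]mulrC.
Qed.

(* The product is real because [sharp] permutes its factors and conjugates them. *)
Lemma prod_charval_sqr i :
  grouplike x star i -> (\prod_j charval j (X i)) ^+ 2 = 1.
Proof.
move=> /eqP gi; set P := \prod_j _.
have Preal : P^* = P.
  rewrite rmorph_prod [RHS](reindex_inj (inv_inj sharpK)).
  by apply: eq_bigr => j _; rewrite charval_sharp.
rewrite expr2 -{2}Preal rmorph_prod -big_split /= big1 // => j _.
(* The modulus of mu_k(x_i) does not depend on k, so it is |d_i| and each factor mu_k(X_i) has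
   modulus 1. *)
have mod_const k : charval k (tnth x i) * (charval k (tnth x i))^* =
    strconst x i (star i) ord0.
  by rewrite -charval_star -charvalM gi charvalZ charval1 mulr1.
rewrite charval_normalized rmorphM fmorphV mulrACA mod_const -(mod_const ord0).
by rewrite -invfM mulVf // mulf_neq0 ?conjC_eq0 // hd.
Qed.

End Sharp.

(** * Grouplike elements and the group idempotent *)

Lemma grouplike_star i : grouplike x star (star i) = grouplike x star i.
Proof.
rewrite /grouplike (hg_starK hH) hab; congr (_ == _ *: _).
by rewrite /strconst hab.
Qed.

Lemma normalized_inj : injective X.
Proof.
move=> i j /(congr1 (coord x i)); rewrite /normalized !linearZ /=.
rewrite !(coord_hg hH) eqxx mulr1; case: eqP => // _.
by rewrite mulr0 => /eqP; rewrite invr_eq0 (negPf (hd i)).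
Qed.

Lemma tau_normalized_mul i j :
  tau (X i * X j) =
  (i == star j)%:R * ((d i)^-1 * (d j)^-1 * strconst x j (star j) ord0).
Proof.
rewrite /normalized -scalerAl -scalerAr scalerA linearZ /=.
rewrite -{2}(hg_starK hH j) (coord0_mul_star hH) (coord_hg hH) (hg_starK hH).
by rewrite mulrCA /strconst hab.
Qed.

(** Only g = i^* can contribute, and it is grouplike exactly when i is. Then applying mu_1 to x_i
    x_{i^*} shows that the contribution is 1. *)
Lemma tau_grouplike_sum i :
  tau ((\sum_(g in grouplikes x star) X g) * X i) = (grouplike x star i)%:R.
Proof.
rewrite mulr_suml linear_sum /=; under eq_bigr => g _ do rewrite tau_normalized_mul.
case: (boolP (grouplike x star i)) => gi; last first.
  rewrite big1 // => g; rewrite inE; case: eqP => [->|_ _]; last by rewrite mul0r.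
  by rewrite grouplike_star (negPf gi).
rewrite (bigD1 (star i)) ?inE ?grouplike_star //= big1 => [|g /andP[_ /negPf ->]].
  rewrite eqxx mul1r addr0 -invfM.
  have -> : strconst x i (star i) ord0 = d (star i) * d i.
    rewrite mulrC; apply: esym; move/eqP: gi => /(congr1 (charval ord0)).
    by rewrite charvalM charvalZ charval1 mulr1.
  by rewrite mulVf // mulf_neq0.
by rewrite mul0r.
Qed.

End Characters.

(** Multiplication by an element of a finite group permutes the group. *)
Lemma mulgroup_sum (C : numClosedFieldType) (H : falgType C) (E : seq H) u :
  uniq E -> mulgroup E -> u \in E -> u * (\sum_(v <- E) v) = \sum_(v <- E) v.
Proof.
move=> Eu [_ Em Ei] uE; have [w wE [uw wu]] := Ei u uE.
rewrite mulr_sumr -(big_map ( *%R u) xpredT id); apply: perm_big.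
have mu : uniq [seq u * v | v <- E].
  by rewrite map_inj_uniq // => a b /(congr1 ( *%R w)); rewrite !mulrA wu !mul1r.
have sub : {subset [seq u * v | v <- E] <= E}.
  by move=> _ /mapP[v vE ->]; exact: Em.
by apply: uniq_perm => //; apply: (uniq_min_size mu sub _).2; rewrite size_map.
Qed.

Section Support.
Variables (C : numClosedFieldType) (H : falgType C) (r : nat).
Variables (x : r.+1.-tuple H) (star : 'I_r.+1 -> 'I_r.+1).
Hypotheses (hH : hypergroup x star) (hab : hgabelian H).
Variables (mu : 'I_r.+1 -> 'AHom(H, C^o)).
Hypothesis hd : normalizable mu x.
Variable G : {set 'I_r.+1}.
Hypothesis hG : mulgroup [seq normalized mu x i | i in G].

Local Notation X := (normalized mu x).
Local Notation L := <<[seq tnth x i | i in G]>>%VS.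

Lemma mul_group_sum v :
  v \in L -> v * (\sum_(i in G) X i) = charval mu ord0 v *: (\sum_(i in G) X i).
Proof.
set S := \sum_(i in G) _.
have XS i : i \in G -> X i * S = S.
  move=> iG.
  have -> : S = \sum_(v <- [seq X j | j in G]) v by rewrite big_image.
  rewrite mulgroup_sum //; last exact: image_f.
  by rewrite map_inj_uniq ?enum_uniq //; exact: normalized_inj hH _ hd.
have xS i : i \in G -> tnth x i * S = charval mu ord0 (tnth x i) *: S.
  by move=> iG; rewrite -{1}(normalizedK hd i) -scalerAl XS.
move=> /(@coord_span _ _ _ (in_tuple _)) ->.
rewrite mulr_suml charval_sum scaler_suml; apply: eq_bigr => k _.
have /mapP[i iG ->] : (in_tuple [seq tnth x i | i in G])`_k \in
    [seq tnth x i | i in G] by exact: mem_nth.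
by rewrite -scalerAl charvalZ -scalerA xS // -mem_enum.
Qed.

(** The average l' of the group is an idempotent of L absorbed by lambda, so lambda = l' + (lambda -
    l') is an orthogonal splitting; primitivity and l' != 0 force lambda = l'. *)
Lemma support_idempotent lambda :
    primitive_idempotent L lambda -> charval mu ord0 lambda = 1 ->
  #|G|%:R *: lambda = \sum_(i in G) X i.
Proof.
set S := \sum_(i in G) _ => -[lL lid _ lprim] l1.
have SL : S \in L.
  apply: memv_suml => i iG; apply/memvZ/memv_span; exact: image_f.
have mu0S : charval mu ord0 S = #|G|%:R.
  rewrite charval_sum (eq_bigr (fun=> 1)) ?sumr_const // => i _.
  exact: charval0_normalized.
have G0 : #|G|%:R != 0 :> C.
  case: hG => /imageP[i iG _] _ _.
  by rewrite pnatr_eq0 -lt0n; apply/card_gt0P; exists i.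
set l' := #|G|%:R^-1 *: S.
have l'L : l' \in L by exact: memvZ.
have mul_l' v : v \in L -> v * l' = charval mu ord0 v *: l'.
  by move=> vL; rewrite /l' -scalerAr mul_group_sum // !scalerA mulrC.
have l'1 : charval mu ord0 l' = 1 by rewrite charvalZ mu0S mulVf.
have l'id : l' * l' = l' by rewrite mul_l' // l'1 scale1r.
have ll' : lambda * l' = l' by rewrite mul_l' // l1 scale1r.
have l'l : l' * lambda = l' by rewrite hab.
have [] := lprim l' (lambda - l') l'L (memvB lL l'L) l'id.
- by rewrite mulrBl !mulrBr lid ll' l'l l'id subrr subr0.
- by rewrite mulrBr l'l l'id subrr.
- by rewrite mulrBl ll' l'id subrr.
- by rewrite addrC subrK.
- by move=> e; move/eqP: l'1; rewrite e charval0 eq_sym oner_eq0.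
by move/eqP; rewrite subr_eq0 => /eqP ->; rewrite scalerA divff ?scale1r.
Qed.

End Support.

(** * Comparison of the two sides at each X_i *)

Theorem theorem1p7 (R : realType) (H : falgType R[i]) (r : nat)
    (x : r.+1.-tuple H) (star : 'I_r.+1 -> 'I_r.+1)
    (hH : hypergroup x star) (hab : hgabelian H)
    (mu : 'I_r.+1 -> 'AHom(H, R[i]^o)) (hmu : bijective mu)
    (hd : normalizable mu x)
    (sharp : 'I_r.+1 -> 'I_r.+1) (hsharp : dual_involution mu x star sharp)
    (F : 'I_r.+1 -> H) (hF : dual_idempotents mu F)
    (IG : {set 'I_r.+1})
    (hIG : is_support mu x F (grouplikes x star) IG)
    (hG : mulgroup [seq normalized mu x i | i in grouplikes x star]) :
  burnside mu x star <->
  dual_mul mu x (dual_prod mu x) (dual_prod mu x) =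
    (#|grouplikes x star|%:R / hgorder mu x star) *:
      (\sum_(j in IG)
         dual_weight mu x sharp j *: (mu j : 'Hom(H, R[i]^o))).
Proof.
case: hIG => lambda [lprim l1 lE].
have hF' i j : mu i (F j) = (i == j)%:R by case: (hF j).
have rhsE i :
    ((#|grouplikes x star|%:R / hgorder mu x star) *:
      (\sum_(j in IG) dual_weight mu x sharp j *: (mu j : 'Hom(H, R[i]^o))))
      (normalized mu x i) = (grouplike x star i)%:R.
  have n0 : hgorder mu x star != 0.
    apply: contra_eq_neq (tau_idempotent hH hab hF' ord0) => e.
    by rewrite [X in _ * X]e mulr0 eq_sym oner_neq0.
  rewrite scale_lfunE (weighted_sum_charvalE hH hab hF' hd hsharp) -lE.
  rewrite -(tau_grouplike_sum hH hab hd) -(support_idempotent hH hab hd hG lprim l1).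
  rewrite -scalerAl [RHS]linearZ /=.
  rewrite -[LHS]/(_ / hgorder mu x star * (hgorder mu x star * _) : R[i]).
  by rewrite mulrA divfK.
have lhsE i :
    dual_mul mu x (dual_prod mu x) (dual_prod mu x) (normalized mu x i) =
    (\prod_j charval mu j (normalized mu x i)) ^+ 2.
  by rewrite (dual_mul_normalized hH hd) (dual_prod_normalized hH hd).
have prod0 i : \prod_j charval mu j (normalized mu x i) = 0 <->
    exists j, mu j (tnth x i) = 0.
  split=> [/eqP/prodf_eq0[j _]|[j e]].
    rewrite charval_normalized mulf_eq0 invr_eq0 (negPf (hd i)) => /eqP e.
    by exists j.
  by rewrite (bigD1 j) //= charval_normalized [charval _ _ _]e mulr0 mul0r.
have prod1 := prod_charval_sqr hH hab hF' hd hsharp.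
split=> [hb|e i].
  apply/(hom_normalizedP hH hd) => i; rewrite lhsE rhsE.
  case: (boolP (grouplike x star i)) => [/prod1 //|/negP gi].
  by rewrite ((prod0 i).2 ((hb i).2 gi)) expr0n.
have {}e : (\prod_j charval mu j (normalized mu x i)) ^+ 2 =
    (grouplike x star i)%:R by rewrite -lhsE e rhsE.
rewrite -prod0; split=> [p0 gi|/negP/negPf gi].
  by move/eqP: e; rewrite p0 gi expr0n eq_sym oner_eq0.
by move/eqP: e; rewrite gi expf_eq0 => /eqP.
Qed.
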